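(* Let $((\mathbf{u},p),(\boldsymbol{\phi},r),\mathbf{y})\in V\times V\times Q_{ad}$ solve the continuous optimality system and let $((\mathbf{u}_h,p_h),(\boldsymbol{\phi}_h,r_h),\mathbf{y}_h)\in V_h\times V_h\times Q_{ad}^h$ solve the discrete optimality system (both written out in the context). Let $R\mathbf u,\bar R\boldsymbol\phi\in X$ be the reconstructions defined in the context. Then there is a constant $C>0$, independent of the mesh-size, such that $$\|\mathbf y-\mathbf y_h\|_Q+\|\mathbf u-R\mathbf u\|_W\le C\big(\|E_h\boldsymbol\phi_h-\Pi_h(E_h\boldsymbol\phi_h)\|_Q+\|\boldsymbol\phi_h-\bar R\boldsymbol\phi\|_h+\|R\mathbf u-\mathbf u_h\|_W\big).$$
   Context: All vector spaces are real. Continuous setting. $X,M,W,Q$ are Hilbert spaces, $V=X\times M$, with $X\subset W\subset X'$ with continuous inclusions ($X'$ the dual of $X$). $E:X\to Q$ is continuous and linear; $Q_{ad}\subset Q$ is nonempty, closed and convex. $\mathbf f,\mathbf u_d\in W$ and $\lambda>0$ are given. $a:X\times X\to\mathbb R$, $b:X\times M\to\mathbb R$ are continuous bilinear forms with $|a(\mathbf v,\mathbf z)|\le C_1\|\mathbf v\|_X\|\mathbf z\|_X$ and $|b(\mathbf z,p)|\le C_2\|\mathbf z\|_X\|p\|_M$; with $Z=\{\mathbf v\in X: b(\mathbf v,w)=0\ \forall w\in M\}$, $a$ is $Z$-elliptic: $\alpha\|\mathbf v\|_X^2\le a(\mathbf v,\mathbf v)$ for all $\mathbf v\in Z$, $\alpha>0$;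 and $b$ satisfies the inf-sup condition $\inf_{p\in M}\sup_{\mathbf z\in X} b(\mathbf z,p)/(\|\mathbf z\|_X\|p\|_M)\ge\beta>0$. Continuous optimality system for $((\mathbf u,p),(\boldsymbol\phi,r),\mathbf y)\in V\times V\times Q_{ad}$: for all $\mathbf z\in X$, $w\in M$, $\mathbf x\in Q_{ad}$, $a(\mathbf u,\mathbf z)+b(\mathbf z,p)=\langle\mathbf y,E\mathbf z\rangle_Q+\langle\mathbf f,\mathbf z\rangle_W$, $b(\mathbf u,w)=0$, $a(\mathbf z,\boldsymbol\phi)-b(\mathbf z,r)=\langle\mathbf u-\mathbf u_d,\mathbf z\rangle_W$, $b(\boldsymbol\phi,w)=0$, $\langle E\boldsymbol\phi+\lambda\mathbf y,\mathbf x-\mathbf y\rangle_Q\ge0$. Discrete setting. $X_h\subset W$ is a finite dimensional subspace, $\|\cdot\|_h$ is a norm on $X+X_h$ with $\|\mathbf v\|_h=\|\mathbf v\|_X$ for $\mathbf v\in X$; $M_h\subset M$ is a finite dimensional subspace with norm $\|\cdot\|_M$; $V_h=X_h\times M_h$; $Q_h\subseteq Q$ is a finite dimensional subspace and $Q_{ad}^h\subset Q_{ad}$ is a nonempty closed convex subset of $Q_h$. $a_h:X_h\times X_h\to\mathbb R$, $b_h:X_h\times M_h\to\mathbb R$ are bilinear with $|a_h(\mathbf v_h,\mathbf z_h)|\le\bar C_1\|\mathbf v_h\|_h\|\mathbf z_h\|_h$, $|b_h(\mathbf z_h,p_h)|\le\bar C_2\|\mathbf z_h\|_h\|p_h\|_M$;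 with $Z_h=\{\mathbf v_h\in X_h:b_h(\mathbf v_h,w_h)=0\ \forall w_h\in M_h\}$, $\bar\alpha\|\mathbf v_h\|_h^2\le a_h(\mathbf v_h,\mathbf v_h)$ on $Z_h$, $\bar\alpha>0$; and $\inf_{p_h\in M_h}\sup_{\mathbf z_h\in X_h}b_h(\mathbf z_h,p_h)/(\|\mathbf z_h\|_h\|p_h\|_M)\ge\bar C>0$. $E_h:X_h+X\to Q$ is linear with $E_h\mathbf v=E\mathbf v$ for $\mathbf v\in X$. Discrete optimality system for $((\mathbf u_h,p_h),(\boldsymbol\phi_h,r_h),\mathbf y_h)\in V_h\times V_h\times Q_{ad}^h$: for all $\mathbf z_h\in X_h$, $w_h\in M_h$, $\mathbf x_h\in Q_{ad}^h$, $a_h(\mathbf u_h,\mathbf z_h)+b_h(\mathbf z_h,p_h)=\langle\mathbf y_h,E_h\mathbf z_h\rangle_Q+\langle\mathbf f,\mathbf z_h\rangle_W$, $b_h(\mathbf u_h,w_h)=0$, $a_h(\mathbf z_h,\boldsymbol\phi_h)-b_h(\mathbf z_h,r_h)=\langle\mathbf u_h-\mathbf u_d,\mathbf z_h\rangle_W$, $b_h(\boldsymbol\phi_h,w_h)=0$, $\langle E_h\boldsymbol\phi_h+\lambda\mathbf y_h,\mathbf x_h-\mathbf y_h\rangle_Q\ge0$. Standing assumptions. (I) $\|\mathbf v\|_W\le C_W\|\mathbf v\|_h$ for all $\mathbf v\in X+X_h$. (II) $\|E_h(\mathbf v-\mathbf v_h)\|_Q\le\|\mathbf v-\mathbf v_h\|_h$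 for all $\mathbf v\in X,\mathbf v_h\in X_h$. (III) $\Pi_h:Q\to Q_h$ is the $Q$-orthogonal projection, and $\Pi_h\mathbf x\in Q_{ad}^h$ whenever $\mathbf x\in Q_{ad}$. Reconstructions. $(R\mathbf u,R_0p),(\bar R\boldsymbol\phi,\bar R_0r)\in X\times M$ are the unique solutions of: for all $\mathbf z\in X$, $w\in M$, $a(R\mathbf u,\mathbf z)+b(\mathbf z,R_0p)=\langle\mathbf y_h,E\mathbf z\rangle_Q+\langle\mathbf f,\mathbf z\rangle_W$, $b(R\mathbf u,w)=0$, $a(\mathbf z,\bar R\boldsymbol\phi)-b(\mathbf z,\bar R_0r)=\langle\mathbf u_h-\mathbf u_d,\mathbf z\rangle_W$, $b(\bar R\boldsymbol\phi,w)=0$. ''Independent of the mesh-size'' means: depending only on $\lambda$ and on the constants $C_1,C_2,\alpha,\beta,\bar C_1,\bar C_2,\bar\alpha,\bar C,C_W$. *)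

(* Defs.v *)
From HB Require Import structures.
From mathcomp Require Import all_boot all_order all_algebra.
From mathcomp Require Import all_classical all_reals all_analysis.

Set Implicit Arguments.
Unset Strict Implicit.
Unset Printing Implicit Defensive.

Import Order.TTheory GRing.Theory Num.Theory.
Import numFieldNormedType.Exports.
Local Open Scope classical_set_scope.
Local Open Scope ring_scope.

HB.mixin Record CompleteNormedModule_isHilbert (R : realType) H
    of CompleteNormedModule R H := {
  inner : {dot H for @idfun R};
  innerxx : forall v : H, inner v v = `|v| ^+ 2
}.

#[short(type="hilbertType")]
HB.structure Definition Hilbert (R : realType) :=
  {H of CompleteNormedModule_isHilbert R H & CompleteNormedModule R H}.

Notation "[< u , v >]" := (inner u v)
  (at level 0, u at level 69, format "[<  u ,  v  >]") : ring_scope.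

(* Subspaces and sets are [set]s of the ambient space.  A map that the text    *)
(* defines only on a subspace is a total function that is constrained on that  *)
(* subspace alone.                                                             *)
Section OnSubsets.
Variable R : realType.

Definition finite_dim_subspace (U : lmodType R) (S : set U) : Prop :=
  exists (n : nat) (e : 'I_n -> U),
    S = [set v | exists c : 'I_n -> R, v = \sum_i c i *: e i].

Definition linear_on (U V : lmodType R) (S : set U) (g : U -> V) : Prop :=
  forall (k : R) (u v : U), S u -> S v -> g (k *: u + v) = k *: g u + g v.

Definition bilinear_form_on (U P : lmodType R) (S : set U) (T : set P)
    (c : U -> P -> R) : Prop :=
  (forall p, T p -> @linear_on U R^o S (c ^~ p)) /\
  (forall u, S u -> @linear_on P R^o T (c u)).

Definition norm_on (U : lmodType R) (S : set U) (n : U -> R) : Prop :=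
  [/\ forall v, S v -> 0 <= n v,
      forall v, S v -> n v = 0 -> v = 0,
      forall k v, S v -> n (k *: v) = `|k| * n v &
      forall u v, S u -> S v -> n (u + v) <= n u + n v].

Definition bounded_form_on (U P : lmodType R) (S : set U) (T : set P)
    (nU : U -> R) (nP : P -> R) (c : U -> P -> R) (K : R) : Prop :=
  forall u p, S u -> T p -> `|c u p| <= K * nU u * nP p.

Definition form_kernel (U P : lmodType R) (S : set U) (T : set P)
    (b : U -> P -> R) : set U :=
  [set v | S v /\ forall w, T w -> b v w = 0].

Definition elliptic_on (U : lmodType R) (Z : set U) (n : U -> R)
    (a : U -> U -> R) (alpha : R) : Prop :=
  forall v, Z v -> alpha * n v ^+ 2 <= a v v.

(* The infimum and the supremum range over nonzero vectors. *)
Definition inf_sup (U P : lmodType R) (S : set U) (T : set P)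
    (nU : U -> R) (nP : P -> R) (b : U -> P -> R) : \bar R :=
  ereal_inf [set ereal_sup [set (b z p / (nU z * nP p))%:E | z in S `\ 0]
            | p in T `\ 0].

End OnSubsets.

(* X `<=` W `<=` X': the inclusion of X in W is [i], and w in W is identified  *)
(* with the functional <w, ->_W on X, whose norm in X' is at most c * |w|.     *)
Definition gelfand_inclusions (R : realType) (X W : hilbertType R)
    (i : {linear X -> W}) : Prop :=
  [/\ injective i,
      continuous i,
      injective (fun (w : W) (z : X) => [< w, i z >]) &
      exists c : R, forall (w : W) (z : X),
        `|[< w, i z >]| <= c * `|w| * `|z| ].

Record continuous_setting (R : realType) (C1 C2 alpha beta : R)
    (X M W Q : hilbertType R) (i : {linear X -> W}) (E : {linear X -> Q})
    (a : {biscalar X}) (b : {bilinear X -> M -> R | *%R & *%R})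
    (Qad : set Q) : Prop := ContinuousSetting {
  cont_inclusions : gelfand_inclusions i;
  cont_E : continuous E;
  cont_Qad_neq0 : Qad !=set0;
  cont_Qad_closed : closed Qad;
  cont_Qad_convex : convex_set Qad;
  cont_a_bounded :
    bounded_form_on setT setT (fun v : X => `|v|) (fun v : X => `|v|) a C1;
  cont_b_bounded :
    bounded_form_on setT setT (fun v : X => `|v|) (fun p : M => `|p|) b C2;
  cont_a_elliptic :
    elliptic_on (form_kernel setT setT b) (fun v : X => `|v|) a alpha;
  cont_inf_sup :
    (beta%:E <=
      (inf_sup setT setT (fun v : X => `|v|) (fun p : M => `|p|) b)%R)%E
}.

Definition sum_space (R : realType) (X W : hilbertType R)
    (i : {linear X -> W}) (Xh : set W) : set W :=
  [set i v + vh | v in setT & vh in Xh].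

Definition orthogonal_projection (R : realType) (Q : hilbertType R)
    (S : set Q) (P : Q -> Q) : Prop :=
  forall x, S (P x) /\ forall q, S q -> [< x - P x, q >] = 0.

Record discrete_setting (R : realType) (C1h C2h alphah betah CW : R)
    (X M W Q : hilbertType R) (i : {linear X -> W}) (E : {linear X -> Q})
    (Qad : set Q) (Xh : set W) (Mh : set M) (Qh Qadh : set Q)
    (nh : W -> R) (ah : W -> W -> R) (bh : W -> M -> R)
    (Eh : W -> Q) (Pih : Q -> Q) : Prop := DiscreteSetting {
  disc_Xh : finite_dim_subspace Xh;
  disc_Mh : finite_dim_subspace Mh;
  disc_Qh : finite_dim_subspace Qh;
  disc_norm : norm_on (sum_space i Xh) nh;
  disc_normX : forall v : X, nh (i v) = `|v|;
  disc_Qadh_Qh : Qadh `<=` Qh;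
  disc_Qadh_Qad : Qadh `<=` Qad;
  disc_Qadh_neq0 : Qadh !=set0;
  disc_Qadh_closed : closed Qadh;
  disc_Qadh_convex : convex_set Qadh;
  disc_ah : bilinear_form_on Xh Xh ah;
  disc_bh : bilinear_form_on Xh Mh bh;
  disc_ah_bounded : bounded_form_on Xh Xh nh nh ah C1h;
  disc_bh_bounded : bounded_form_on Xh Mh nh (fun p : M => `|p|) bh C2h;
  disc_ah_elliptic : elliptic_on (form_kernel Xh Mh bh) nh ah alphah;
  disc_inf_sup :
    (betah%:E <= (inf_sup Xh Mh nh (fun p : M => `|p|) bh)%R)%E;
  disc_Eh : linear_on (sum_space i Xh) Eh;
  disc_EhX : forall v : X, Eh (i v) = E v;
  disc_W_le : forall v : W, sum_space i Xh v -> `|v| <= CW * nh v;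
  disc_Eh_le : forall (v : X) (vh : W), Xh vh ->
    `|Eh (i v - vh)| <= nh (i v - vh);
  disc_Pih : orthogonal_projection Qh Pih;
  disc_Pih_Qad : forall x : Q, Qad x -> Qadh (Pih x)
}.

(* The continuous problems and the discrete one have the same shape: trial and *)
(* test functions range over S x T in U x P, and U is mapped to W by j (the    *)
(* inclusion of X for the continuous problems, the identity for X_h in W).     *)
Section Systems.
Variables (R : realType) (U P : lmodType R) (W Q : hilbertType R).
Variables (S : set U) (T : set P) (j : U -> W) (E : U -> Q).
Variables (a : U -> U -> R) (b : U -> P -> R).

Definition state_solution (f : W) (y : Q) (u : U) (p : P) : Prop :=
  [/\ S u, T p,
      forall z, S z -> a u z + b z p = [< y, E z >] + [< f, j z >] &
      forall w, T w -> b u w = 0].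

Definition adjoint_solution (g : W) (phi : U) (r : P) : Prop :=
  [/\ S phi, T r,
      forall z, S z -> a z phi - b z r = [< g, j z >] &
      forall w, T w -> b phi w = 0].

Definition optimality_system (lambda : R) (A : set Q) (f ud : W)
    (u : U) (p : P) (phi : U) (r : P) (y : Q) : Prop :=
  [/\ A y,
      state_solution f y u p,
      adjoint_solution (j u - ud) phi r &
      forall x, A x -> 0 <= [< E phi + lambda *: y, x - y >]].

End Systems.

(* Main.v *)
Require Import Defs.
From HB Require Import structures.
From mathcomp Require Import all_boot all_order all_algebra.
From mathcomp Require Import all_classical all_reals all_analysis.
From mathcomp Require Import ring lra.

(* Testing the two variational inequalities with y_h and Pi_h y and adding     *)
(* them bounds lambda |y - y_h|^2 by <Pi_h E_h phi_h - E phi, y - y_h>.  The   *)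
(* part <E (Rbar phi - phi), y - y_h> of the right-hand side is rewritten with *)
(* the state and adjoint equations: since both errors lie in Z, it equals      *)
(* <u_h - u, u - R u>_W, which is -|u - R u|_W^2 up to <u_h - R u, u - R u>_W. *)
(* The square moves to the left and Cauchy-Schwarz bounds what remains.        *)

Import Order.TTheory GRing.Theory Num.Theory.
Import numFieldNormedType.Exports.
Local Open Scope classical_set_scope.
Local Open Scope ring_scope.

(** [control_error_le] carries the argument on the variational inequalities, [adjoint_state_duality]
    the duality identity, applied to the exact solution and its reconstruction. What results is
    quadratic in the two errors on the left; [add_le_of_sqr_le] makes it linear, with constant
    [2 / Num.min lambda 1]. *)

Lemma innerC {R : realType} {H : hilbertType R} (u v : H) :
  [< u, v >] = [< v, u >].
Proof. by rewrite hermC /= expr0 mul1r. Qed.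

Lemma innerBl {R : realType} {H : hilbertType R} (u v w : H) :
  [< u - v, w >] = [< u, w >] - [< v, w >].
Proof. exact: linearBl. Qed.

Lemma innerBr {R : realType} {H : hilbertType R} (u v w : H) :
  [< w, u - v >] = [< w, u >] - [< w, v >].
Proof. exact: linearBr. Qed.

Lemma innerDl {R : realType} {H : hilbertType R} (u v w : H) :
  [< u + v, w >] = [< u, w >] + [< v, w >].
Proof. exact: linearDl. Qed.

Lemma innerZl {R : realType} {H : hilbertType R} (k : R) (u w : H) :
  [< k *: u, w >] = k * [< u, w >].
Proof. exact: linearZl_LR. Qed.

(** Expand the square of the norm of [|v| u - |u| v] and divide by [|u| |v|]. *)
Lemma inner_le_norm {R : realType} {H : hilbertType R} (u v : H) :
  [< u, v >] <= `|u| * `|v|.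
Proof.
have [->|u0] := eqVneq u 0; first by rewrite linear0l normr0 mul0r.
have [->|v0] := eqVneq v 0; first by rewrite linear0r normr0 mulr0.
have uv_gt0 : 0 < `|u| * `|v| by rewrite mulr_gt0 ?normr_gt0.
have : 0 <= [< `|v| *: u - `|u| *: v, `|v| *: u - `|u| *: v >].
  by rewrite innerxx sqr_ge0.
rewrite !(innerBl, innerBr, innerZl) !(innerC _ (_ *: _)) !innerZl.
rewrite !innerxx (innerC v u) => sq_ge0.
rewrite -(ler_pM2l uv_gt0); lra.
Qed.

(** Test with [yh] and [P y]. As [yh], [P y] and [P gh] lie in [Qh], orthogonality gives
    [<gh, P y - yh> = <P gh, y - yh>] and [<yh, P y> = <yh, y>], so adding the inequalities leaves
    only [y - yh]. *)
Lemma control_error_le {R : realType} {Q : hilbertType R} {lambda : R}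
    {Qh : set Q} {P : Q -> Q} {A Ah : set Q} {g gh y yh : Q} :
  orthogonal_projection Qh P ->
  Ah `<=` Qh -> Ah `<=` A -> (forall x, A x -> Ah (P x)) -> A y -> Ah yh ->
  (forall x, A x -> 0 <= [< g + lambda *: y, x - y >]) ->
  (forall x, Ah x -> 0 <= [< gh + lambda *: yh, x - yh >]) ->
  lambda * `|y - yh| ^+ 2 <= [< P gh - g, y - yh >].
Proof.
move=> orthP AhQh AhA PA Ay Ahyh /(_ _ (AhA _ Ahyh)) + /(_ _ (PA _ Ay)).
have Qyh := AhQh _ Ahyh.
have [QPy Py] := orthP y; have [QPg Pg] := orthP gh.
move: (Pg _ QPy) (Pg _ Qyh) (Py _ QPg) (Py _ Qyh).
rewrite -innerxx !(innerBl, innerDl, innerBr, innerZl).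
rewrite !(innerC yh) (innerC (P gh) (P y)) (innerC y (P gh)).
(* This orthogonality relation is substituted because its terms occur multiplied by [lambda], out of
   reach of linear arithmetic. *)
move=> ? ? ? /subr0_eq->; lra.
Qed.

(** Both sides equal [a (u - uh) (phih - phi)]: the [b] terms vanish because the state and adjoint
    differences lie in the kernel of [b]. *)
Lemma adjoint_state_duality {R : realType} {X M W Q : hilbertType R}
    {i : {linear X -> W}} {E : {linear X -> Q}}
    {a : {biscalar X}} {b : {bilinear X -> M -> R | *%R & *%R}}
    {f g gh : W} {y yh : Q} {u uh phi phih : X} {p ph r rh : M} :
  state_solution setT setT i E a b f y u p ->
  state_solution setT setT i E a b f yh uh ph ->
  adjoint_solution setT setT i a b g phi r ->
  adjoint_solution setT setT i a b gh phih rh ->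
  [< y - yh, E (phih - phi) >] = [< gh - g, i (u - uh) >].
Proof.
move=> [_ _ su bu] [_ _ suh buh] [_ _ sphi bphi] [_ _ sphih bphih].
have := (su (phih - phi) I, suh (phih - phi) I).
have := (sphi (u - uh) I, sphih (u - uh) I).
rewrite !(linearBl, linearBr) /=.
rewrite !bu // !buh // !bphi // !bphih //.
move=> [A1 A2] [B1 B2]; lra.
Qed.

(** With [m] the minimum, [m (s + t)^2 <= 2 m (s^2 + t^2) <= 2 (G s + D t) <= 2 (G + D) (s + t)];
    divide by [m (s + t)]. *)
Lemma add_le_of_sqr_le (R : realFieldType) (lambda s t G D : R) :
  0 < lambda -> 0 <= s -> 0 <= t -> 0 <= G -> 0 <= D ->
  lambda * s ^+ 2 + t ^+ 2 <= G * s + D * t ->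
  s + t <= 2 / Num.min lambda 1 * (G + D).
Proof.
move=> lambda_gt0 s0 t0 G0 D0 h.
set m := Num.min _ _.
have m_gt0 : 0 < m by rewrite lt_min lambda_gt0 ltr01.
have [ml m1] : m <= lambda /\ m <= 1 by rewrite !ge_min !lexx orbT.
rewrite mulrAC ler_pdivlMr //.
have [st0|st_gt0] := leP (s + t) 0.
  have -> : s + t = 0 by lra.
  by rewrite mul0r mulr_ge0 ?addr_ge0.
rewrite -(ler_pM2r st_gt0).
have h1 : m * s ^+ 2 <= lambda * s ^+ 2 by rewrite ler_wpM2r ?sqr_ge0.
have h2 : m * t ^+ 2 <= t ^+ 2 by rewrite ler_piMl ?sqr_ge0.
have h3 : 0 <= m * (s - t) ^+ 2 by rewrite mulr_ge0 ?sqr_ge0 ?ltW.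
have h4 : 0 <= G * t by exact: mulr_ge0.
have h5 : 0 <= D * s by exact: mulr_ge0.
lra.
Qed.

Theorem theorem2p7 (R : realType)
    (lambda C1 C2 alpha beta C1h C2h alphah betah CW : R)
    (lambda_gt0 : 0 < lambda) (alpha_gt0 : 0 < alpha) (beta_gt0 : 0 < beta)
    (alphah_gt0 : 0 < alphah) (betah_gt0 : 0 < betah) :
  exists2 C : R, 0 < C &
  forall (X M W Q : hilbertType R) (i : {linear X -> W}) (E : {linear X -> Q})
    (a : {biscalar X}) (b : {bilinear X -> M -> R | *%R & *%R})
    (Qad : set Q) (f ud : W)
    (Xh : set W) (Mh : set M) (Qh Qadh : set Q) (nh : W -> R)
    (ah : W -> W -> R) (bh : W -> M -> R) (Eh : W -> Q) (Pih : Q -> Q),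
  continuous_setting C1 C2 alpha beta i E a b Qad ->
  discrete_setting C1h C2h alphah betah CW i E Qad Xh Mh Qh Qadh
    nh ah bh Eh Pih ->
  forall (u : X) (p : M) (phi : X) (r : M) (y : Q)
    (uh : W) (ph : M) (phih : W) (rh : M) (yh : Q)
    (Ru : X) (R0p : M) (Rphi : X) (R0r : M),
  optimality_system setT setT i E a b lambda Qad f ud u p phi r y ->
  optimality_system Xh Mh id Eh ah bh lambda Qadh f ud uh ph phih rh yh ->
  state_solution setT setT i E a b f yh Ru R0p ->
  adjoint_solution setT setT i a b (uh - ud) Rphi R0r ->
  `|y - yh| + `|i u - i Ru| <=
    C * (`|Eh phih - Pih (Eh phih)| + nh (phih - i Rphi) + `|i Ru - uh|).
Proof.
have m_gt0 : 0 < Num.min lambda 1 by rewrite lt_min lambda_gt0 ltr01.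
exists (2 / Num.min lambda 1); first by rewrite divr_gt0.
move=> X M W Q i E a b Qad f ud Xh Mh Qh Qadh nh ah bh Eh Pih _ ds.
move=> u p phi r y uh ph phih rh yh Ru R0p Rphi R0r.
move=> [Ay su sphi vi] [Ayh [Xuh _ _ _] [Xphih _ _ _] vih] sRu sRphi.
have [n [e eX]] := disc_Xh ds.
(* [Eh] is linear, and [nh] a norm, only on [sum_space i Xh], so membership is checked first. *)
have sumB v vh : Xh vh -> sum_space i Xh (i v - vh).
  move=> Xvh; exists v => //; exists (- vh) => //.
  move: Xvh; rewrite eX => -[c ->]; exists (fun k => - c k).
  by rewrite -sumrN; apply: eq_bigr => k _; rewrite scaleNr.
have sumX v : sum_space i Xh (i v).
  rewrite -[i v]subr0; apply: sumB; rewrite eX.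
  by exists (fun=> 0); rewrite big1 // => k _; rewrite scale0r.
have sumXh v : Xh v -> sum_space i Xh v.
  by move=> Xv; exists 0 => //; exists v => //; rewrite raddf0 add0r.
have [nh_ge0 _ nhZ _] := disc_norm ds.
have nh_sym : nh (phih - i Rphi) = nh (i Rphi - phih).
  by rewrite -opprB -scaleN1r nhZ ?normrN1 ?mul1r //; exact: sumB.
(* Assumption (II), since [E Rphi = Eh (i Rphi)]. *)
have Eh_le : `|Eh phih - E Rphi| <= nh (phih - i Rphi).
  have EhB := disc_Eh ds (-1) (sumXh _ Xphih) (sumX Rphi).
  rewrite -(disc_EhX ds) -normrN opprB addrC -scaleN1r -EhB scaleN1r addrC.
  by rewrite nh_sym; exact: (disc_Eh_le ds).
have control := control_error_le (disc_Pih ds) (disc_Qadh_Qh ds)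
  (disc_Qadh_Qad ds) (disc_Pih_Qad ds) Ay Ayh vi vih.
have := adjoint_state_duality su sRu sphi sRphi.
rewrite opprB addrA subrK !raddfB /= => dual.
(* Here [G] is the sum of the projection and adjoint residuals, which multiply the control error,
   and [D] is the state residual. *)
apply: add_le_of_sqr_le => //.
  by rewrite addr_ge0 // nh_sym nh_ge0 //; exact: sumB.
have proj_le := inner_le_norm (Pih (Eh phih) - Eh phih) (y - yh).
have adj_le : [< Eh phih - E Rphi, y - yh >] <= nh (phih - i Rphi) * `|y - yh|.
  by apply: le_trans (inner_le_norm _ _) _; rewrite ler_wpM2r.
have state_le := inner_le_norm (uh - i Ru) (i u - i Ru).
rewrite [`|uh - _|]distrC in state_le.
rewrite [`|Pih _ - _|]distrC in proj_le.
rewrite 2!(innerC (y - yh)) in dual.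
(* Written as an inner product, the square cancels against the one hidden in [dual]. *)
rewrite -(innerxx (i u - i Ru)).
rewrite !(innerBl, innerBr) in state_le dual control proj_le adj_le *.
lra.
Qed.
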